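(* Let $\alpha\in\mathbb{R}\setminus\{0,1\}$, $\alpha^*=1-\alpha$ and $L\in\mathcal{L}$. Then: (1) The mapping $\mathcal{L}(\pi)\ni M\mapsto D_\alpha(M\|L)$ (resp. $D_{\alpha^*}(L\|M)$) admits a unique minimizer $M^f$, given for $x\ne y\in\mathcal{X}$ by $$M^f(x,y)=\left(\frac{L(x,y)^{\alpha^*}+L_\pi(x,y)^{\alpha^*}}{2}\right)^{1/\alpha^*}=P_{\alpha^*}(x,y).$$ In particular, when $L$ admits $\pi$ as its stationary distribution, $M^f(x,y)=\left(\frac{L(x,y)^{\alpha^*}+L^*(x,y)^{\alpha^*}}{2}\right)^{1/\alpha^*}$. (2) The mapping $\mathcal{L}(\pi)\ni M\mapsto D_\alpha(L\|M)$ (resp. $D_{\alpha^*}(M\|L)$) admits a unique minimizer $M^{f^*}$, given for $x\neq y\in\mathcal{X}$ by $$M^{f^*}(x,y)=\left(\frac{L(x,y)^{\alpha}+L_\pi(x,y)^{\alpha}}{2}\right)^{1/\alpha}=P_\alpha(x,y).$$ In particular, when $L$ admits $\pi$ as its stationary distribution, $M^{f^*}(x,y)=\left(\frac{L(x,y)^{\alpha}+L^*(x,y)^{\alpha}}{2}\right)^{1/\alpha}$. (3) (Pythagorean identity) For any $\overline{M}\in\mathcal{L}(\pi)$, $$D_\alpha(L\|\overline{M})=D_\alpha(L\|M^{f^*})+D_\alpha(M^{f^*}\|\overline{M}),$$ $$D_\alpha(\overline{M}\|L)=D_\alpha(\overline{M}\|M^f)+D_\alpha(M^f\|L).$$ (4)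 (Bisection property) $$D_\alpha(L\|M^{f^*})=D_\alpha(L_\pi\|M^{f^*}),\qquad D_\alpha(M^f\|L)=D_\alpha(M^f\|L_\pi).$$ In particular, when $L$ admits $\pi$ as its stationary distribution, $D_\alpha(L\|M^{f^*})=D_\alpha(L^*\|M^{f^*})$ and $D_\alpha(M^f\|L)=D_\alpha(M^f\|L^* )$. (5) (Parallelogram law) For any $\overline{M}\in\mathcal{L}(\pi)$, $$D_\alpha(L\|\overline{M})+D_\alpha(L_\pi\|\overline{M})=2D_\alpha(L\|M^{f^*})+2D_\alpha(M^{f^*}\|\overline{M}),$$ $$D_\alpha(\overline{M}\|L)+D_\alpha(\overline{M}\|L_\pi)=2D_\alpha(\overline{M}\|M^f)+2D_\alpha(M^f\|L).$$
   Context: $\mathcal{X}$ is a finite set and $\pi$ is a fixed probability distribution on $\mathcal{X}$ with $\pi(x)>0$ for all $x$. $\mathcal{L}$ is the set of Markov infinitesimal generators on $\mathcal{X}$, i.e. $\mathcal{X}\times\mathcal{X}$ real matrices with non-negative off-diagonal entries and all row sums zero. $\mathcal{L}(\pi)\subseteq\mathcal{L}$ is the set of $\pi$-reversible generators, i.e. those $M$ with $\pi(x)M(x,y)=\pi(y)M(y,x)$ for all $x,y$. $L$ admits $\pi$ as stationary distribution if $\pi L=0$. The $\pi$-dual $L_\pi$ of $L\in\mathcal{L}$ is the generator with off-diagonal entries $L_\pi(x,y)=\frac{\pi(y)}{\pi(x)}L(y,x)$, $x\neq y$, and diagonal entries such that all row sums are zero. When $L$ admits $\pi$ as its stationary distribution,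 $L_\pi=L^*$, the adjoint of $L$ in $\ell^2(\pi)$ (the time-reversal). For $M,L\in\mathcal{L}$ and convex $f$ with $f(1)=0$, the $f$-divergence is $$D_f(M\|L):=\sum_{x\in\mathcal{X}}\pi(x)\sum_{y\in\mathcal{X}\setminus\{x\}}L(x,y)\,f\!\left(\frac{M(x,y)}{L(x,y)}\right),$$ with the convention $0f(a/0)=0$ for $a\ge 0$. For $\alpha\in\mathbb{R}\setminus\{0,1\}$ let $$f_\alpha(t):=\frac{t^\alpha-\alpha t-(1-\alpha)}{\alpha(\alpha-1)}$$ (with $f_\alpha(0)$ the limit as $t\to0^+$, possibly $+\infty$), and $D_\alpha:=D_{f_\alpha}$, $D_{\alpha^*}:=D_{f_{\alpha^*}}$. For $p\in\mathbb{R}\setminus\{0\}$ the power mean reversiblization $P_p$ has off-diagonal entries $P_p(x,y)=\left(\frac{L(x,y)^p+L_\pi(x,y)^p}{2}\right)^{1/p}$, $x\ne y$, and diagonal entries such that all row sums are zero; for $p<0$ the expression is understood by continuity as $0$ if $L(x,y)=0$ or $L_\pi(x,y)=0$. The minimizers $M^f$ and $M^{f^*}$ likewise have diagonal entries determined by zero row sums.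
   Formalization: The convention 0f(a/0)=0 for a>0 is replaced by 0f(a/0)=a·lim f(t)/t as t→∞ (keeping 0f(0/0)=0); under the original convention the zero generator gives D_α(L‖0)=0, so the minimizer claim and the Pythagorean identity fail. *)

(* Defs.v *)
From HB Require Import structures.
From mathcomp Require Import all_boot all_order all_algebra.
From mathcomp Require Import ring lra.
From mathcomp Require Import all_classical all_reals all_analysis.

Set Implicit Arguments.
Unset Strict Implicit.
Unset Printing Implicit Defensive.

Import Order.TTheory GRing.Theory Num.Theory.
Import numFieldNormedType.Exports.

Local Open Scope classical_set_scope.
Local Open Scope ring_scope.

(* Real X x X matrices are represented as functions X -> X -> R. *)

Section Generators.
Context {R : realType} {X : finType}.
Implicit Types (pi : X -> R) (L M : X -> X -> R).

Definition generator : set (X -> X -> R) :=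
  [set L | (forall x y, x != y -> 0 <= L x y) /\
           (forall x, \sum_y L x y = 0)].

Definition reversible_generator pi : set (X -> X -> R) :=
  [set M | generator M /\ forall x y, pi x * M x y = pi y * M y x].

Definition stationary pi L : Prop := forall y, \sum_x pi x * L x y = 0.

Definition generator_of_offdiag (K : X -> X -> R) : X -> X -> R :=
  fun x y => if x == y then - \sum_(z | z != x) K x z else K x y.

Definition pi_dual pi L : X -> X -> R :=
  generator_of_offdiag (fun x y => pi y / pi x * L y x).

(* A matrix acts on functions by (L f)(x) = \sum_y L x y * f y. *)
Definition is_adjoint pi L Ls : Prop := forall f g : X -> R,
  \sum_x pi x * (\sum_y L x y * f y) * g x =
  \sum_x pi x * f x * (\sum_y Ls x y * g y).

End Generators.

Section PowerMean.
Context {R : realType}.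

(* The case distinction is needed because in the library 0 `^ p = 0 also when
   p < 0, whereas the limit of the power mean at a vanishing argument is 0. *)
Definition power_mean (p a b : R) : R :=
  if (p < 0) && ((a == 0) || (b == 0)) then 0
  else ((a `^ p + b `^ p) / 2) `^ p^-1.

Definition power_mean_rev {X : finType} (pi : X -> R) (L : X -> X -> R)
    (p : R) : X -> X -> R :=
  generator_of_offdiag (fun x y => power_mean p (L x y) (pi_dual pi L x y)).

End PowerMean.

Section Divergence.
Context {R : realType}.
Local Open Scope ereal_scope.

(* [persp f a b] is b * f (a / b). At b = 0 it is extended by lower
   semicontinuity: 0 * f (0 / 0) = 0 (as 0 * +oo = 0 in \bar R) and, for a > 0,
   0 * f (a / 0) = lim_(b -> 0+) b * f (a / b) = a * lim_(t -> +oo) f t / t.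
   The cruder convention 0 * f (a / 0) = 0 for a > 0 would make the divergence
   of any generator from the zero generator vanish, so that the minimization
   problems in the second argument would degenerate; [fdiv_abs_cont] shows that
   the choice is irrelevant under absolute continuity. *)
Definition persp (f : R -> \bar R) (a b : R) : \bar R :=
  if b == 0%R then a%:E * lim (f t * (t^-1)%:E @[t --> +oo%R])
  else b%:E * f (a / b)%R.

Definition fdiv (f : R -> \bar R) {X : finType} (pi : X -> R)
    (M L : X -> X -> R) : \bar R :=
  \sum_(x : X) (pi x)%:E * \sum_(y | y != x) persp f (M x y) (L x y).

Definition falpha_pos (alpha t : R) : R :=
  ((t `^ alpha - alpha * t - (1 - alpha)) / (alpha * (alpha - 1)))%R.

Definition falpha (alpha t : R) : \bar R :=
  if t == 0%R then lim ((falpha_pos alpha s)%:E @[s --> 0%R^'+])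
  else (falpha_pos alpha t)%:E.

Definition Dalpha (alpha : R) {X : finType} (pi : X -> R)
    (M L : X -> X -> R) : \bar R := fdiv (falpha alpha) pi M L.

End Divergence.

Definition minimizer {R : realType} {T : Type} (A : set T) (F : T -> \bar R)
    (m : T) : Prop := A m /\ forall m', A m' -> (F m <= F m')%E.

Definition unique_minimizer {R : realType} {T : Type} (A : set T)
    (F : T -> \bar R) (m : T) : Prop := unique (minimizer A F) m.

Lemma is_adjointP {R : realType} {X : finType} (pi : X -> R)
    (L Ls : X -> X -> R) : (forall x, 0 < pi x) ->
  is_adjoint pi L Ls <-> forall x y, Ls x y = pi y / pi x * L y x.
Proof.
move=> pi_gt0; split=> [adj x y|E f g].
  have sum_delta (F : X -> R) z : \sum_t F t * (t == z)%:R = F z.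
    rewrite (bigD1 z) //= eqxx mulr1 big1 ?addr0 // => t tz.
    by rewrite (negbTE tz) mulr0.
  have := adj (fun z => (z == x)%:R) (fun z => (z == y)%:R).
  rewrite sum_delta sum_delta; under eq_bigr do rewrite sum_delta mulrAC.
  rewrite sum_delta => h; apply: (mulfI (lt0r_neq0 (pi_gt0 x))).
  by rewrite -h mulrA mulrCA divff ?mulr1 ?lt0r_neq0.
under eq_bigr do rewrite mulr_sumr mulr_suml.
rewrite exchange_big /=; apply: eq_bigr => x _; rewrite mulr_sumr.
apply: eq_bigr => y _; rewrite E; have := lt0r_neq0 (pi_gt0 x) => px.
by field.
Qed.

Lemma fdiv_abs_cont {R : realType} (f : R -> \bar R) {X : finType}
    (pi : X -> R) (M L : X -> X -> R) :
  (forall x y, x != y -> L x y = 0 -> M x y = 0) ->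
  fdiv f pi M L = (\sum_(x : X) (pi x)%:E *
    \sum_(y | y != x)
      if L x y == 0%R then 0 else (L x y)%:E * f (M x y / L x y)%R)%E.
Proof.
move=> ac; apply: eq_bigr => x _; congr (_ * _)%E; apply: eq_bigr => y yx.
rewrite /persp; case: ifPn => // /eqP L0.
by rewrite (ac x y) ?mul0e // eq_sym.
Qed.

Section FalphaLimits.
Context {R : realType}.
Implicit Types alpha : R.

Lemma powR_cvgy alpha : alpha < 0 -> s `^ alpha @[s --> 0^'+] --> +oo.
Proof.
move=> a0; pose f (s : R) := s `^ (- alpha).
have -> : (fun s : R => s `^ alpha) = (fun s => (f s)^-1).
  by apply/funext => s; rewrite /f powRN invrK.
apply/cvgrVy; last by apply: powR_cvg0; rewrite oppr_gt0.
by near=> s; apply: powR_gt0; near: s; exact: nbhs_right_gt.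
Unshelve. all: by end_near. Qed.

Lemma falpha_cvg0 alpha : alpha != 0 -> alpha != 1 ->
  (falpha_pos alpha s)%:E @[s --> 0^'+] -->
  (if 0 < alpha then (alpha^-1)%:E else +oo%E).
Proof.
move=> a0 a1; case: ifPn => [agt0|].
  apply: cvg_EFin; first by apply: nearW.
  have -> : alpha^-1 = (0 - alpha * 0 - (1 - alpha)) / (alpha * (alpha - 1)).
    have a1' : alpha - 1 != 0 by rewrite subr_eq0.
    by field; rewrite a0 a1'.
  apply: cvgMl; apply: cvgB; last exact: cvg_cst.
  apply: cvgB; first exact: powR_cvg0.
  by apply: cvgMr; apply: cvg_at_right_filter; exact: cvg_id.
rewrite -leNgt le_eqVlt (negbTE a0) /= => alt0; apply/cvgeryP.
have c0 : 0 < (alpha * (alpha - 1))^-1.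
  by rewrite invr_gt0 nmulr_rgt0 // subr_lt0 (lt_trans alt0).
apply: gt0_cvgMly => //; apply/cvgryPge => A.
have /cvgryPge /(_ (A + (1 - alpha))) H := powR_cvgy alt0.
near=> s.
have s0 : 0 < s by near: s; exact: nbhs_right_gt.
have : A + (1 - alpha) <= s `^ alpha by near: s.
have : alpha * s < 0 by rewrite nmulr_rlt0.
by lra.
Unshelve. all: by end_near. Qed.

Lemma falpha0E alpha : alpha != 0 -> alpha != 1 ->
  falpha alpha 0 = if 0 < alpha then (alpha^-1)%:E else +oo%E.
Proof.
by move=> a0 a1; rewrite /falpha eqxx; apply/cvg_lim => //; exact: falpha_cvg0.
Qed.

Lemma falpha_slope alpha : alpha != 0 -> alpha != 1 ->
  lim (falpha alpha t * (t^-1)%:E @[t --> +oo%R])%E =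
  if alpha < 1 then ((1 - alpha)^-1)%:E else +oo%E.
Proof.
move=> a0 a1; apply/cvg_lim => //; rewrite -subr_gt0.
have b0 : 1 - alpha != 0 by rewrite subr_eq0 eq_sym.
have b1 : 1 - alpha != 1.
  by rewrite -subr_eq0 addrAC subrr add0r oppr_eq0.
have invt : t^-1 @[t --> +oo] --> (0 : R)^'+.
  move=> A [e /= e0 eA]; exists e^-1; split; first by rewrite num_real.
  move=> t et; have t0 : 0 < t by rewrite (lt_trans _ et) // invr_gt0.
  apply: eA => /=; last by rewrite invr_gt0.
  by rewrite sub0r normrN gtr0_norm ?invr_gt0 // invf_plt ?posrE.
apply: cvg_trans (cvg_comp _ _ invt (falpha_cvg0 b0 b1)).
apply: near_eq_cvg; near=> t.
have t0 : 0 < t by near: t; exact: nbhs_pinfty_gt.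
rewrite /= /falpha gt_eqF // -EFinM; congr (_%:E); rewrite /falpha_pos.
have -> : t^-1 `^ (1 - alpha) = t `^ alpha / t.
  rewrite -powR_inv1 ?ltW // -powRrM mulN1r opprB.
  by rewrite powRD ?(gt_eqF t0) ?implybT // powR_inv1 ?ltW.
have a1' : alpha - 1 != 0 by rewrite subr_eq0.
by field; rewrite a0 b0 a1' gt_eqF // subr_eq0 b1.
Unshelve. all: by end_near. Qed.

End FalphaLimits.

(* Main.v *)
Require Import Defs.
From mathcomp Require Import all_boot all_order all_algebra.
From mathcomp Require Import ring lra.
From mathcomp Require Import all_classical all_reals all_analysis.

Import Order.TTheory GRing.Theory Num.Theory.
Import numFieldNormedType.Exports.

(** The alpha-divergence is a sum of perspectives W(a, b) = b f_alpha(a / b),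
    weighted by pi. Up to the infinite values at the boundary,

      alpha (alpha - 1) W(a, b) = a^alpha b^(1-alpha) - alpha a - (1-alpha) b.

    Three features of W give the whole theorem.

    - As a function of the first argument, W(a, m) depends on a affinely through
      a^alpha and a. Hence if P is the power mean of order alpha of a and b, so
      that a^alpha + b^alpha = 2 P^alpha, then
        W(a, m) + W(b, m) = W(a, P) + W(b, P) + 2 W(P, m)
      ([persp_falpha_parallelogram]); this also holds when terms are infinite.
    - W is homogeneous, so when M is pi-reversible,
      pi(x) W(L_pi(x,y), M(x,y)) = pi(y) W(L(y,x), M(y,x)): exchanging x and y in
      the sum shows D(L_pi || M) = D(L || M) ([Dalpha_pi_dual]). This is the
      bisection property.
    - W >= 0, with equality only when a = b ([persp_falpha_dist]).

    Summing the first identity with a = L(x,y), b = L_pi(x,y), m = M(x,y) and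
    replacing D(L_pi || P) by D(L || P) gives the parallelogram law. Replacing
    D(L_pi || M) by D(L || M) there and halving gives the Pythagorean identity
    D(L || M) = D(L || P) + D(P || M). As D(L || P) is finite and D(P || M) >= 0
    vanishes only for M = P, the power mean P is the unique minimizer.

    This settles the minimization over the second argument. The one over the
    first argument is the same problem for 1 - alpha, because
    D_alpha(M || L) = D_(1-alpha)(L || M) ([Dalpha_swap]). *)

Local Open Scope ring_scope.

(** * The perspective of the alpha-divergence generator *)

Section AlphaPerspective.
Context {R : realType}.
Implicit Types (alpha a b c m : R).

(** The value of b f_alpha(a / b) for a, b > 0. Since 0 `^ p = 0 for p <> 0, it is
    also the right value on the boundary wherever that value is finite. *)
Definition alpha_persp alpha a b : R :=
  (a `^ alpha * b `^ (1 - alpha) - alpha * a - (1 - alpha) * b)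
    / (alpha * (alpha - 1)).

(** The boundary points where the perspective is infinite: those where a
    vanishing a or b is raised to a negative power while the other factor is
    positive. *)
Definition alpha_singular alpha a b : bool :=
  (alpha < 0) && (a == 0) && (b != 0) || (1 < alpha) && (b == 0) && (a != 0).

Lemma persp_falphaE alpha a b : alpha != 0 -> alpha != 1 -> 0 <= a -> 0 <= b ->
  persp (falpha alpha) a b =
  if alpha_singular alpha a b then +oo%E else (alpha_persp alpha a b)%:E.
Proof.
move=> al0 al1 a0 b0.
have al1' : 1 - alpha != 0 by rewrite subr_eq0 eq_sym.
have al1'' : alpha - 1 != 0 by rewrite subr_eq0.
rewrite /persp /alpha_singular /alpha_persp.
have [->|b_neq0] := eqVneq b 0.
  rewrite falpha_slope // andbF orFb andbT (powR0 al1').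
  case: (ltgtP alpha 1) al1 => // [alt1|alt1] _ /=.
    by rewrite -EFinM; congr (_%:E); field; rewrite al0 al1' al1''.
  have [->|a_neq0] := eqVneq a 0.
    by rewrite mul0e powR0 //; congr (_%:E); rewrite !(mul0r, mulr0) !subr0 mul0r.
  by rewrite gt0_muley // lte_fin lt0r a_neq0.
have bgt0 : 0 < b by rewrite lt0r b_neq0.
rewrite andbT andbF andFb orbF.
have [->|a_neq0] := eqVneq a 0.
  rewrite mul0r falpha0E // powR0 // andbT.
  case: (ltgtP alpha 0) (al0) => // [alt0|alt0] _ /=.
    by rewrite gt0_muley // lte_fin.
  by rewrite -EFinM; congr (_%:E); field; rewrite al0 al1''.
rewrite andbF /falpha mulf_eq0 invr_eq0 (negbTE a_neq0) (negbTE b_neq0) /=.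
rewrite -EFinM; congr (_%:E); rewrite /falpha_pos.
rewrite powRM ?invr_ge0 // -(powR_inv1 b0) -powRrM mulN1r.
rewrite powRN powRB ?b_neq0 ?implybT // powRr1 // powR_inv1 //.
have := powR_gt0 alpha bgt0; rewrite lt0r => /andP[bal _].
by field; rewrite al0 al1'' b_neq0 bal.
Qed.

Lemma alpha_perspC alpha a b :
  alpha_persp alpha a b = alpha_persp (1 - alpha) b a.
Proof.
rewrite /alpha_persp subKr; congr (_ / _); first by ring.
by rewrite addrAC subrr add0r mulrN -mulNr opprB mulrC.
Qed.

Lemma alpha_singularC alpha a b :
  alpha_singular alpha a b = alpha_singular (1 - alpha) b a.
Proof.
by rewrite /alpha_singular subr_lt0 ltrBrDr -ltrBrDl subrr orbC.
Qed.

(** The generator f_alpha is exchanged with f_(1-alpha) by t f(1 / t), which is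
    what exchanging the two arguments of the perspective does to it. *)
Lemma perspC alpha a b : alpha != 0 -> alpha != 1 -> 0 <= a -> 0 <= b ->
  persp (falpha alpha) a b = persp (falpha (1 - alpha)) b a.
Proof.
move=> al0 al1 a0 b0; rewrite !persp_falphaE //.
- by rewrite alpha_perspC alpha_singularC.
- by rewrite subr_eq0 eq_sym.
- by rewrite -subr_eq0 addrAC subrr add0r oppr_eq0.
Qed.

(** With G the geometric mean and d = ln a - ln b, one has a = G exp((1-w) d) and
    b = G exp(-w d). The bound 1 + u < exp u, applied to both exponentials, gives
    the claim because the linear terms (1-w) d and - w d have weighted sum 0. *)
Lemma powR_geo_mean_lt w a b : 0 < w -> w < 1 -> 0 < a -> 0 < b -> a != b ->
  a `^ w * b `^ (1 - w) < w * a + (1 - w) * b.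
Proof.
move=> w0 w1 a0 b0 ab.
have dneq0 : ln a - ln b != 0.
  by rewrite subr_eq0; apply: contra_neq ab; apply: ln_inj; rewrite posrE.
set d := ln a - ln b in dneq0.
set G := a `^ w * b `^ (1 - w).
have GE : G = expR (w * ln a + (1 - w) * ln b).
  by rewrite /G /powR !gt_eqF // -expRD.
have aE : a = G * expR ((1 - w) * d).
  by rewrite GE -expRD -[LHS]lnK ?posrE //; congr expR; rewrite /d; ring.
have bE : b = G * expR (- w * d).
  by rewrite GE -expRD -[LHS]lnK ?posrE //; congr expR; rewrite /d; ring.
have G0 : 0 < G by rewrite GE expR_gt0.
have w10 : 1 - w != 0 by rewrite subr_eq0 gt_eqF.
have wN0 : - w != 0 by rewrite oppr_eq0 gt_eqF.
have ua := expR_gt1Dx (mulf_neq0 w10 dneq0).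
have ub := expR_gt1Dx (mulf_neq0 wN0 dneq0).
rewrite {1}aE {1}bE; set u := expR _ in ua *; set v := expR _ in ub *.
have -> : w * (G * u) + (1 - w) * (G * v) =
    G + (w * G * (u - (1 + (1 - w) * d)) + (1 - w) * G * (v - (1 + - w * d))).
  by ring.
by rewrite ltrDl addr_gt0 // !mulr_gt0 // ?powR_gt0 ?subr_gt0.
Qed.


(** This is a weighted arithmetic-geometric mean inequality in disguise. With
    G := a^alpha * b^(1-alpha), for 0 < alpha < 1 the claim is G < alpha a +
    (1-alpha) b, the denominator alpha (alpha - 1) being negative. For alpha > 1 one
    weight is negative, and it is a that is the geometric mean of G and b, with
    weights 1/alpha and 1 - 1/alpha. The case alpha < 0 is the case alpha > 1
    with a and b exchanged. *)
Lemma alpha_persp_gt0 alpha a b : alpha != 0 -> alpha != 1 ->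
  0 < a -> 0 < b -> a != b -> 0 < alpha_persp alpha a b.
Proof.
have gt1_case al x y : 1 < al -> 0 < x -> 0 < y -> x != y ->
    0 < alpha_persp al x y.
  move=> al1 x0 y0 xy; have al0 : 0 < al by exact: lt_trans al1.
  rewrite /alpha_persp divr_gt0 ?mulr_gt0 ?subr_gt0 //.
  set G := x `^ al * y `^ (1 - al).
  have G0 : 0 < G by rewrite mulr_gt0 ?powR_gt0.
  (* x as the geometric mean of G and y *)
  have GE : G `^ al^-1 * y `^ (1 - al^-1) = x.
    rewrite /G powRM ?powR_ge0 // -!powRrM -mulrA -powRD; last first.
      by rewrite (gt_eqF y0) implybT.
    rewrite divff ?gt_eqF // powRr1 ?ltW //.
    have -> : (1 - al) / al + (1 - al^-1) = 0 by field; rewrite gt_eqF.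
    by rewrite powRr0 mulr1.
  have Gy : G != y.
    apply: contra_neq xy => Gy; move: GE.
    rewrite Gy -powRD ?(gt_eqF y0) ?implybT //.
    by rewrite addrC subrK powRr1 ?ltW.
  have := powR_geo_mean_lt al^-1 G y; rewrite GE invr_gt0 invf_lt1 //.
  move=> /(_ al0 al1 G0 y0 Gy) amgm.
  have : al * x < al * (al^-1 * G + (1 - al^-1) * y) by rewrite ltr_pM2l.
  have -> : al * (al^-1 * G + (1 - al^-1) * y) = G - (1 - al) * y.
    by field; rewrite gt_eqF.
  by lra.
move=> al0 al1 a0 b0 ab.
case: (ltgtP alpha 1) (al1) => // [alt1|agt1] _; last first.
  exact: gt1_case.
case: (ltgtP alpha 0) (al0) => // [alt0|agt0] _.
  by rewrite alpha_perspC gt1_case 1?eq_sym // ltrBrDr -ltrBrDl subrr.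
rewrite /alpha_persp nmulr_rgt0.
  by rewrite invr_lt0 pmulr_rlt0 // subr_lt0.
by have := powR_geo_mean_lt alpha a b agt0 alt1 a0 b0 ab; lra.
Qed.

Lemma persp_falpha_dist alpha a b : alpha != 0 -> alpha != 1 ->
  0 <= a -> 0 <= b -> a != b -> (0 < persp (falpha alpha) a b)%E.
Proof.
move=> al0 al1 a0 b0 ab; rewrite persp_falphaE //.
case: ifPn => // nsing; rewrite lte_fin.
have [a_eq0|a_neq0] := eqVneq a 0.
  move: ab nsing; rewrite a_eq0 eq_sym /alpha_singular eqxx andbT andbF orbF.
  move=> b_neq0; rewrite b_neq0 andbT -leNgt.
  rewrite le_eqVlt eq_sym (negbTE al0) /= => agt0.
  rewrite /alpha_persp powR0 // mul0r.
  have -> : (0 - alpha * 0 - (1 - alpha) * b) / (alpha * (alpha - 1)) = b / alpha.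
    by field; rewrite al0 subr_eq0 al1.
  by rewrite divr_gt0 // lt0r b_neq0.
have [b_eq0|b_neq0] := eqVneq b 0.
  move: nsing; rewrite b_eq0 /alpha_singular eqxx andbT andbF orFb.
  rewrite a_neq0 andbT -leNgt le_eqVlt (negbTE al1) /= => alt1.
  rewrite /alpha_persp powR0 ?subr_eq0 1?eq_sym // mulr0.
  have -> : (0 - alpha * a - (1 - alpha) * 0) / (alpha * (alpha - 1))
    = a / (1 - alpha).
    by field; rewrite al0 !subr_eq0 (eq_sym 1) al1.
  by rewrite divr_gt0 ?subr_gt0 // lt0r a_neq0.
by apply: alpha_persp_gt0; rewrite // lt0r ?a_neq0 ?b_neq0.
Qed.

Lemma persp_falpha_refl alpha a : alpha != 0 -> alpha != 1 -> 0 <= a ->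
  persp (falpha alpha) a a = 0%E.
Proof.
move=> al0 al1 a0; rewrite persp_falphaE // /alpha_singular.
rewrite -!andbA !andbN !andbF; congr (_%:E); rewrite /alpha_persp.
have -> : a `^ alpha * a `^ (1 - alpha) = a.
  by rewrite -powRD subrKC ?oner_eq0 // powRr1.
by rewrite (_ : a - _ - _ = 0) ?mul0r //; ring.
Qed.

Lemma persp_falpha_ge0 alpha a b : alpha != 0 -> alpha != 1 ->
  0 <= a -> 0 <= b -> (0 <= persp (falpha alpha) a b)%E.
Proof.
move=> al0 al1 a0 b0; have [->|ab] := eqVneq a b.
  by rewrite persp_falpha_refl.
exact/ltW/persp_falpha_dist.
Qed.

Lemma perspM (f : R -> \bar R) c a b : 0 < c ->
  persp f (c * a) (c * b) = (c%:E * persp f a b)%E.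
Proof.
move=> c0; rewrite /persp mulf_eq0 (gt_eqF c0) /=; case: ifP => [_|b0].
  by rewrite EFinM muleA.
rewrite EFinM muleA (_ : c * a / (c * b) = a / b) //.
by rewrite -mulf_div divff ?mul1r ?gt_eqF.
Qed.

(** * Power means and the pointwise parallelogram identity *)

Lemma power_mean_ge0 p a b : 0 <= power_mean p a b.
Proof. by rewrite /power_mean; case: ifP => // _; exact: powR_ge0. Qed.

Lemma power_meanC p a b : power_mean p a b = power_mean p b a.
Proof. by rewrite /power_mean orbC addrC. Qed.

Lemma power_meanM p c a b : p != 0 -> 0 < c -> 0 <= a -> 0 <= b ->
  power_mean p (c * a) (c * b) = c * power_mean p a b.
Proof.
move=> p0 c0 a0 b0; rewrite /power_mean !mulf_eq0 (gt_eqF c0) /=.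
case: ((p < 0) && _); first by rewrite mulr0.
rewrite (@powRM _ c a) ?(ltW c0) // (@powRM _ c b) ?(ltW c0) //.
rewrite -mulrDr -mulrA powRM ?powR_ge0 //; last first.
  by rewrite divr_ge0 ?addr_ge0 ?powR_ge0.
by rewrite -powRrM divff // powRr1 ?ltW.
Qed.

Lemma power_mean_eq0 p a b : 0 < p -> 0 <= a -> 0 <= b ->
  (power_mean p a b == 0) = (a == 0) && (b == 0).
Proof.
move=> p0 a0 b0; rewrite /power_mean ltNge (ltW p0) /= powR_eq0 invr_eq0.
rewrite (gt_eqF p0) andbT mulf_eq0 invr_eq0 (pnatr_eq0 R 2) orbF.
by rewrite paddr_eq0 ?powR_ge0 // !powR_eq0 (gt_eqF p0) !andbT.
Qed.

(** The excluded case is the one where the mean is 0 by convention while a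
    negative power of a or b would be infinite. *)
Lemma powR_power_mean p a b : p != 0 ->
  (p < 0) && ((a == 0) || (b == 0)) = false ->
  a `^ p + b `^ p = 2 * power_mean p a b `^ p.
Proof.
move=> p0 ndeg; rewrite /power_mean ndeg -powRrM mulVf // powRr1.
  by rewrite mulrCA divff ?mulr1 // pnatr_eq0.
by rewrite divr_ge0 ?addr_ge0 ?powR_ge0.
Qed.

(** Multiplying the hypothesis by m^(1-alpha) and by P^(1-alpha) matches the power
    terms; the latter product is P^alpha P^(1-alpha) = P, which compensates the
    linear terms in P. *)
Lemma alpha_persp_parallelogram alpha a b P m : 0 <= P ->
  alpha != 0 -> alpha != 1 ->
  a `^ alpha + b `^ alpha = 2 * P `^ alpha ->
  alpha_persp alpha a m + alpha_persp alpha b m =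
  alpha_persp alpha a P + alpha_persp alpha b P + 2 * alpha_persp alpha P m.
Proof.
move=> P0 al0 al1 PE; rewrite /alpha_persp -!mulrDl mulrA -mulrDl; congr (_ / _).
have PP : P `^ alpha * P `^ (1 - alpha) = P.
  by rewrite -powRD subrKC ?oner_eq0 // powRr1.
have := congr1 ( *%R^~ (m `^ (1 - alpha))) PE.
have := congr1 ( *%R^~ (P `^ (1 - alpha))) PE.
rewrite /= !mulrDl -!mulrA PP => h1 h2.
by lra.
Qed.

(** Outside the boundary this is [alpha_persp_parallelogram]. If alpha < 0 and a
    or b vanishes, then P = 0: for m = 0 both sides coincide term by term, and for
    m > 0 both are infinite, by the vanishing argument on the left and by P on
    the right. If alpha > 1, m = 0 and a or b is positive, then P > 0 and both
    sides are again infinite. Everywhere else all five terms are finite. *)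
Lemma persp_falpha_parallelogram alpha a b m : alpha != 0 -> alpha != 1 ->
  0 <= a -> 0 <= b -> 0 <= m ->
  let P := power_mean alpha a b in
  (persp (falpha alpha) a m + persp (falpha alpha) b m =
   persp (falpha alpha) a P + persp (falpha alpha) b P
   + 2%:E * persp (falpha alpha) P m)%E.
Proof.
move=> al0 al1 a0 b0 m0 P; have P0 : 0 <= P by exact: power_mean_ge0.
have nNy x y : 0 <= x -> 0 <= y -> persp (falpha alpha) x y != -oo%E.
  move=> x0 y0.
  by rewrite gt_eqF // (lt_le_trans _ (persp_falpha_ge0 _ _ _ _ _ _ _)).
case: (boolP ((alpha < 0) && ((a == 0) || (b == 0)))) => [deg|/negbTE ndeg].
  have -> : P = 0 by rewrite /P /power_mean deg.
  have [->|m_neq0] := eqVneq m 0.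
    by rewrite persp_falpha_refl // mule0 adde0.
  case/andP: deg => alt0 ab0.
  have inf : persp (falpha alpha) 0 m = +oo%E.
    by rewrite persp_falphaE // /alpha_singular alt0 eqxx m_neq0.
  rewrite inf gt0_muley ?lte_fin // addey; last first.
    by rewrite adde_eq_ninfty negb_or !nNy.
  by case/orP: ab0 => /eqP ->; rewrite inf ?addye ?addey ?nNy.
have PE := powR_power_mean _ _ _ al0 ndeg.
have P_eq0 : 0 < alpha -> (P == 0) = (a == 0) && (b == 0).
  by move=> agt0; rewrite power_mean_eq0.
have neg_neq0 : alpha < 0 -> [/\ a != 0, b != 0 & P != 0].
  move=> alt0; move: ndeg; rewrite alt0 /= => /negbT; rewrite negb_or.
  case/andP=> ha hb; split=> //; rewrite /P /power_mean (negbTE ha) (negbTE hb).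
  rewrite andbF powR_eq0 negb_and mulf_neq0 ?invr_eq0 ?pnatr_eq0 //.
  by rewrite gt_eqF // ltr_pwDl ?powR_ge0 ?powR_gt0 // lt0r ha.
have [/andP[al_gt1 /andP[/eqP m_eq0 ab]]|nsing] :=
    boolP [&& 1 < alpha, m == 0 & (a != 0) || (b != 0)].
  have inf x : 0 <= x -> x != 0 -> persp (falpha alpha) x m = +oo%E.
    move=> x0 x_neq0; rewrite persp_falphaE // /alpha_singular m_eq0 eqxx.
    by rewrite al_gt1 x_neq0 orbT.
  rewrite (inf P) ?P_eq0 ?negb_and ?(lt_trans ltr01) // gt0_muley ?lte_fin //.
  rewrite addey ?adde_eq_ninfty ?negb_or ?nNy //.
  by case/orP: ab => nz; [rewrite (inf a) // addye | rewrite (inf b) // addey];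
    rewrite // nNy.
have regular x y : (alpha < 0 -> x != 0) -> (1 < alpha -> y == 0 -> x == 0) ->
    0 <= x -> 0 <= y -> persp (falpha alpha) x y = (alpha_persp alpha x y)%:E.
  move=> hx hy x0 y0; rewrite persp_falphaE // /alpha_singular.
  case: (ltP alpha 0) hx => [alt0 /(_ isT) /negbTE -> |_ _].
    by rewrite /= ltNge (ltW (lt_trans alt0 ltr01)).
  case: (ltP 1 alpha) hy => //= _ /(_ isT).
  by case: eqP => //= _ ->.
have m_reg : 1 < alpha -> m == 0 -> (a == 0) && (b == 0).
  by move=> al_gt1 mz; move: nsing; rewrite al_gt1 mz /= negb_or !negbK.
have pos : 1 < alpha -> 0 < alpha by exact: lt_trans.
rewrite !regular //.
  by rewrite -EFinM -!EFinD; congr (_%:E); exact: alpha_persp_parallelogram.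
all: try by move=> /neg_neq0[].
- by move=> h; rewrite P_eq0 ?pos //; exact: m_reg.
- by move=> h; rewrite P_eq0 ?pos // => /andP[].
- by move=> h; rewrite P_eq0 ?pos // => /andP[].
- by move=> h /(m_reg h) /andP[].
- by move=> h /(m_reg h) /andP[].
Qed.

End AlphaPerspective.

(** * Generators, duals and divergences *)

Lemma mule_fin_inj {R : realType} (r : R) : 0 < r ->
  injective (fun x : \bar R => r%:E * x)%E.
Proof.
move=> r0 x y /= rxy; apply: le_anti; have rE : (0 < r%:E)%E by rewrite lte_fin.
by rewrite -(lee_pmul2l _ rE) // -[(y <= x)%O](lee_pmul2l _ rE) // rxy lexx.
Qed.

Section Generators.
Context {R : realType} {X : finType}.
Variable pi : X -> R.
Hypothesis pi_gt0 : forall x, 0 < pi x.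
Implicit Types (L M K : X -> X -> R) (alpha : R).

Definition offdiag_ge0 L : Prop := forall x y : X, x != y -> 0 <= L x y.

Lemma generator_of_offdiag_neq K x y : x != y ->
  generator_of_offdiag K x y = K x y.
Proof. by move=> /negbTE xy; rewrite /generator_of_offdiag xy. Qed.

Lemma generator_generator_of_offdiag K :
  offdiag_ge0 K -> generator (generator_of_offdiag K).
Proof.
move=> K0; split=> [x y xy|x]; first by rewrite generator_of_offdiag_neq // K0.
rewrite (bigD1 x) //= {1}/generator_of_offdiag eqxx.
under [X in _ + X]eq_bigr => y yx do
  rewrite generator_of_offdiag_neq 1?eq_sym //.
by rewrite addNr.
Qed.

(** Row sums being 0 determine the diagonal, so a divergence, which sees only the
    off-diagonal entries, can identify a generator. *)
Lemma generator_eq_offdiag L M : generator L -> generator M ->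
  (forall x y, x != y -> L x y = M x y) -> L = M.
Proof.
move=> [_ L0] [_ M0] LM; apply/funext => x; apply/funext => y.
have [<-|] := eqVneq x y; last exact: LM.
have := etrans (L0 x) (esym (M0 x)); rewrite (bigD1 x) //= [in RHS](bigD1 x) //=.
rewrite (eq_bigr (M x)) => [|z zx]; last by rewrite LM // eq_sym.
exact: addIr.
Qed.

Lemma pi_dualE L x y : x != y -> pi_dual pi L x y = pi y / pi x * L y x.
Proof. exact: generator_of_offdiag_neq. Qed.

Lemma pi_dual_ge0 L : offdiag_ge0 L -> offdiag_ge0 (pi_dual pi L).
Proof.
move=> L0 x y xy; rewrite pi_dualE // mulr_ge0 ?L0 1?eq_sym //.
by rewrite divr_ge0 // ltW.
Qed.

Lemma mulr_pi_dual L x y : x != y -> pi x * pi_dual pi L x y = pi y * L y x.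
Proof.
move=> xy; rewrite pi_dualE // mulrA mulrCA divff ?mulr1 //.
by rewrite gt_eqF.
Qed.

Lemma power_mean_revE L p x y : x != y ->
  power_mean_rev pi L p x y = power_mean p (L x y) (pi_dual pi L x y).
Proof. exact: generator_of_offdiag_neq. Qed.

(** Power means are homogeneous, so pi(x) P(x,y) is the mean of pi(x) L(x,y) and
    pi(x) L_pi(x,y) = pi(y) L(y,x), which is symmetric in x and y. *)
Lemma reversible_power_mean_rev L p : p != 0 -> offdiag_ge0 L ->
  reversible_generator pi (power_mean_rev pi L p).
Proof.
move=> p0 L0; split.
  by apply: generator_generator_of_offdiag => x y _; exact: power_mean_ge0.
have Ld := pi_dual_ge0 _ L0.
have symE x y : x != y -> pi x * power_mean_rev pi L p x y =
    power_mean p (pi x * L x y) (pi y * L y x).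
  move=> xy; rewrite power_mean_revE // -(mulr_pi_dual L x y) //.
  by symmetry; apply: power_meanM => //; [exact: L0|exact: Ld].
move=> x y; have [->//|xy] := eqVneq x y.
have yx : y != x by rewrite eq_sym.
rewrite (symE x y xy) (symE y x yx); exact: power_meanC.
Qed.

Lemma eq_Dalpha alpha M M' L L' :
  (forall x y, x != y -> M x y = M' x y) ->
  (forall x y, x != y -> L x y = L' x y) ->
  Dalpha alpha pi M L = Dalpha alpha pi M' L'.
Proof.
move=> MM LL; apply: eq_bigr => x _; congr (_ * _)%E; apply: eq_bigr => y yx.
by rewrite MM 1?eq_sym // LL 1?eq_sym.
Qed.

Lemma Dalpha_swap alpha M L : alpha != 0 -> alpha != 1 ->
  offdiag_ge0 M -> offdiag_ge0 L ->
  Dalpha alpha pi M L = Dalpha (1 - alpha) pi L M.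
Proof.
move=> al0 al1 M0 L0; apply: eq_bigr => x _; congr (_ * _)%E.
by apply: eq_bigr => y yx; rewrite perspC // ?M0 ?L0 // eq_sym.
Qed.

Section Divergence.
Variable alpha : R.
Hypotheses (al0 : alpha != 0) (al1 : alpha != 1).
Local Notation D := (Dalpha alpha pi).
Local Notation W := (persp (falpha alpha)).

Lemma persp_offdiag_ge0 M L x y : offdiag_ge0 M -> offdiag_ge0 L ->
  y != x -> (0 <= W (M x y) (L x y))%E.
Proof.
by move=> M0 L0 yx; rewrite persp_falpha_ge0 ?M0 ?L0 // eq_sym.
Qed.

Lemma DalphaE M L : offdiag_ge0 M -> offdiag_ge0 L ->
  D M L = (\sum_x \sum_(y | y != x) (pi x)%:E * W (M x y) (L x y))%E.
Proof.
move=> M0 L0; apply: eq_bigr => x _; rewrite ge0_sume_distrr // => y yx.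
exact: persp_offdiag_ge0.
Qed.

Lemma Dalpha_term_ge0 M L x y : offdiag_ge0 M -> offdiag_ge0 L ->
  y != x -> (0 <= (pi x)%:E * W (M x y) (L x y))%E.
Proof.
move=> M0 L0 yx; apply: mule_ge0; first by rewrite lee_fin ltW.
exact: persp_offdiag_ge0.
Qed.

Lemma Dalpha_ge0 M L : offdiag_ge0 M -> offdiag_ge0 L -> (0 <= D M L)%E.
Proof.
move=> M0 L0; rewrite DalphaE //; apply: sume_ge0 => x _; apply: sume_ge0 => y yx.
exact: Dalpha_term_ge0.
Qed.

Lemma Dalpha_eq0 M L : offdiag_ge0 M -> offdiag_ge0 L -> D M L = 0%E ->
  forall x y, x != y -> M x y = L x y.
Proof.
move=> M0 L0 D0 x y xy; have yx : y != x by rewrite eq_sym.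
have W0 u v : v != u -> (0 <= (pi u)%:E * W (M u v) (L u v))%E.
  exact: Dalpha_term_ge0.
apply/eqP/negPn/negP => ne; move: D0; rewrite DalphaE //.
move/eqP; rewrite seq_psume_eq0 => [|u _]; last by apply: sume_ge0; exact: W0.
move/allP => /(_ x (mem_index_enum _)) /=.
rewrite seq_psume_eq0 => [|v]; last exact: W0.
move/allP => /(_ y (mem_index_enum _)).
rewrite yx /= gt_eqF // mule_gt0 ?lte_fin //.
by rewrite persp_falpha_dist ?M0 ?L0.
Qed.

(** By homogeneity the term of (x, y) on one side is the term of (y, x) on the
    other. *)
Lemma Dalpha_pi_dual L M : offdiag_ge0 L -> reversible_generator pi M ->
  D (pi_dual pi L) M = D L M.
Proof.
move=> L0 [[M0 _] Mrev]; have Ld := pi_dual_ge0 _ L0.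
rewrite !DalphaE // (exchange_big_dep xpredT) //=; apply: eq_bigr => y _.
rewrite (eq_bigl (fun x => x != y)) => [|x]; last by rewrite eq_sym.
apply: eq_bigr => x xy.
by rewrite -!perspM // mulr_pi_dual // Mrev.
Qed.

(** * Projection onto the reversible generators *)

Section Projection.
Variable L : X -> X -> R.
Hypothesis L_ge0 : offdiag_ge0 L.
Let P := power_mean_rev pi L alpha.

Let revP : reversible_generator pi P.
Proof. exact: reversible_power_mean_rev. Qed.

Let P_ge0 : offdiag_ge0 P.
Proof. by case: revP => -[]. Qed.

Lemma Dalpha_parallelogram M : reversible_generator pi M ->
  (D L M + D (pi_dual pi L) M = 2%:E * D L P + 2%:E * D P M)%E.
Proof.
move=> revM; have M_ge0 : offdiag_ge0 M by case: revM => -[].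
have Ld := pi_dual_ge0 _ L_ge0.
(* Splits the doubled term by bisection, so that it matches the pair
   W(a, P) + W(b, P) of the pointwise identity. *)
have -> : (2%:E * D L P = D L P + D (pi_dual pi L) P)%E.
  rewrite Dalpha_pi_dual //.
  by rewrite -[2]/(1 + 1) EFinD ge0_muleDl ?mul1e // lee_fin.
rewrite !DalphaE // ge0_sume_distrr => [|x _]; last first.
  by apply: sume_ge0 => y yx; exact: Dalpha_term_ge0.
rewrite -!big_split /=; apply: eq_bigr => x _.
rewrite ge0_sume_distrr => [|y yx]; last exact: Dalpha_term_ge0.
rewrite -!big_split /=; apply: eq_bigr => y yx.
have xy : x != y by rewrite eq_sym.
rewrite muleCA -!ge0_muleDr ?adde_ge0 ?mule_ge0 ?persp_offdiag_ge0 //.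
congr (_ * _)%E; rewrite /P power_mean_revE //.
by rewrite persp_falpha_parallelogram ?L_ge0 ?Ld ?M_ge0.
Qed.

Lemma Dalpha_pythagoras M : reversible_generator pi M ->
  (D L M = D L P + D P M)%E.
Proof.
move=> revM; have M_ge0 : offdiag_ge0 M by case: revM => -[].
have := Dalpha_parallelogram _ revM; rewrite Dalpha_pi_dual //.
have -> : (D L M + D L M = 2%:E * D L M)%E.
  by rewrite -[2]/(1 + 1) EFinD ge0_muleDl ?mul1e // lee_fin.
rewrite -ge0_muleDr ?Dalpha_ge0 //; apply: mule_fin_inj; exact: ltr0n.
Qed.

(** Needed to cancel D(L || P) when deriving uniqueness. The power mean avoids
    both sources of infinite terms: for alpha < 0 it vanishes where L does, and for
    alpha > 1 it vanishes only where L does. *)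
Lemma Dalpha_power_mean_fin_num : (D L P \is a fin_num)%E.
Proof.
have Ld := pi_dual_ge0 _ L_ge0.
rewrite fin_numElt (lt_le_trans _ (Dalpha_ge0 _ _ _ _)) //= DalphaE //.
apply/lte_sum_pinfty => x _; apply/lte_sum_pinfty => y yx.
have xy : x != y by rewrite eq_sym.
rewrite lte_mul_pinfty ?lee_fin ?ltW // persp_falphaE ?L_ge0 ?P_ge0 //.
case: ifP => [|_]; last exact: ltry.
rewrite /alpha_singular /P power_mean_revE //.
case/orP => /andP[/andP[]].
  move=> alt0 Lx0; rewrite /power_mean alt0 Lx0 /= eqxx //.
move=> agt1; rewrite power_mean_eq0 ?L_ge0 ?Ld ?(lt_trans ltr01) //.
by case/andP => /eqP ->; rewrite eqxx.
Qed.

Lemma Dalpha_unique_minimizer :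
  unique_minimizer (reversible_generator pi) (fun M => D L M) P.
Proof.
split=> [|M [revM minM]].
  split=> [//|M revM]; have M_ge0 : offdiag_ge0 M by case: revM => -[].
  by rewrite (Dalpha_pythagoras M revM) leeDl // Dalpha_ge0.
have M_ge0 : offdiag_ge0 M by case: revM => -[].
apply: generator_eq_offdiag; [by case: revP|by case: revM|].
apply: Dalpha_eq0 => //; apply/eqP; rewrite eq_le Dalpha_ge0 // andbT.
have := minM _ revP; rewrite (Dalpha_pythagoras M revM).
by rewrite -[X in (_ <= X)%E]adde0 leeD2lE // Dalpha_power_mean_fin_num.
Qed.

End Projection.
End Divergence.
End Generators.

Lemma eq_unique_minimizer {R : realType} {T : Type} (A : classical_sets.set T)
    (F G : T -> \bar R) (m : T) : (forall t, A t -> F t = G t) ->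
  unique_minimizer A F m -> unique_minimizer A G m.
Proof.
move=> FG [[Am minm] uniqm]; split.
  by split=> // t At; rewrite -!FG // minm.
by move=> t [At mint]; apply: uniqm; split=> // t' At'; rewrite !FG // mint.
Qed.

Theorem theorem3p3 (R : realType) (X : finType) (pi : X -> R)
    (pi_gt0 : forall x : X, 0 < pi x) (pi_sum1 : \sum_(x : X) pi x = 1)
    (alpha : R) (alpha_neq0 : alpha <> 0) (alpha_neq1 : alpha <> 1)
    (L : X -> X -> R) (genL : generator L) :
  let alphas := 1 - alpha in
  let Lpi := pi_dual pi L in
  let Mf := power_mean_rev pi L alphas in
  let Mfs := power_mean_rev pi L alpha in
  (* (1) *)
  (unique_minimizer (reversible_generator pi)
     (fun M => Dalpha alpha pi M L) Mf /\
   unique_minimizer (reversible_generator pi)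
     (fun M => Dalpha alphas pi L M) Mf /\
   (forall x y : X, x != y -> Mf x y = power_mean alphas (L x y) (Lpi x y)) /\
   (stationary pi L -> forall Ls : X -> X -> R, is_adjoint pi L Ls ->
      forall x y : X, x != y -> Mf x y = power_mean alphas (L x y) (Ls x y))) /\
  (* (2) *)
  (unique_minimizer (reversible_generator pi)
     (fun M => Dalpha alpha pi L M) Mfs /\
   unique_minimizer (reversible_generator pi)
     (fun M => Dalpha alphas pi M L) Mfs /\
   (forall x y : X, x != y -> Mfs x y = power_mean alpha (L x y) (Lpi x y)) /\
   (stationary pi L -> forall Ls : X -> X -> R, is_adjoint pi L Ls ->
      forall x y : X, x != y -> Mfs x y = power_mean alpha (L x y) (Ls x y))) /\
  (* (3) Pythagorean identity *)
  (forall Mb : X -> X -> R, reversible_generator pi Mb ->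
     Dalpha alpha pi L Mb
       = (Dalpha alpha pi L Mfs + Dalpha alpha pi Mfs Mb)%E /\
     Dalpha alpha pi Mb L
       = (Dalpha alpha pi Mb Mf + Dalpha alpha pi Mf L)%E) /\
  (* (4) bisection property *)
  (Dalpha alpha pi L Mfs = Dalpha alpha pi Lpi Mfs /\
   Dalpha alpha pi Mf L = Dalpha alpha pi Mf Lpi /\
   (stationary pi L -> forall Ls : X -> X -> R, is_adjoint pi L Ls ->
      Dalpha alpha pi L Mfs = Dalpha alpha pi Ls Mfs /\
      Dalpha alpha pi Mf L = Dalpha alpha pi Mf Ls)) /\
  (* (5) parallelogram law *)
  (forall Mb : X -> X -> R, reversible_generator pi Mb ->
     (Dalpha alpha pi L Mb + Dalpha alpha pi Lpi Mb
       = 2%:E * Dalpha alpha pi L Mfs + 2%:E * Dalpha alpha pi Mfs Mb)%E /\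
     (Dalpha alpha pi Mb L + Dalpha alpha pi Mb Lpi
       = 2%:E * Dalpha alpha pi Mb Mf + 2%:E * Dalpha alpha pi Mf L)%E).
Proof.
move=> alphas Lpi Mf Mfs.
have al0 : alpha != 0 by exact/eqP.
have al1 : alpha != 1 by exact/eqP.
have als0 : alphas != 0 by rewrite subr_eq0 eq_sym.
have als1 : alphas != 1 by rewrite -subr_eq0 addrAC subrr add0r oppr_eq0.
have L_ge0 : offdiag_ge0 L by case: genL.
have Lpi_ge0 : offdiag_ge0 Lpi by exact: pi_dual_ge0.
have rev_ge0 M : reversible_generator pi M -> offdiag_ge0 M by case=> -[].
have revMf : reversible_generator pi Mf by exact: reversible_power_mean_rev.
have Mf_ge0 := rev_ge0 _ revMf.
(* Turns every statement about the first argument of D_alpha into one about the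
   second argument of D_(1 - alpha). *)
have swapl M K : offdiag_ge0 M -> offdiag_ge0 K ->
    Dalpha alphas pi M K = Dalpha alpha pi K M.
  by move=> M0 K0; rewrite [RHS]Dalpha_swap.
have adjE Ls : is_adjoint pi L Ls -> forall x y, x != y -> Ls x y = Lpi x y.
  by move=> /(is_adjointP _ _ pi_gt0) E x y xy; rewrite E /Lpi pi_dualE.
have revE p : (forall x y, x != y -> power_mean_rev pi L p x y =
      power_mean p (L x y) (Lpi x y)) /\
    (stationary pi L -> forall Ls, is_adjoint pi L Ls -> forall x y, x != y ->
      power_mean_rev pi L p x y = power_mean p (L x y) (Ls x y)).
  split=> [|_ Ls /adjE E] x y xy; first exact: power_mean_revE.
  by rewrite E // power_mean_revE.
have min := Dalpha_unique_minimizer _ pi_gt0 _ al0 al1 _ L_ge0.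
have mins := Dalpha_unique_minimizer _ pi_gt0 _ als0 als1 _ L_ge0.
have bis M : reversible_generator pi M ->
    Dalpha alpha pi L M = Dalpha alpha pi Lpi M.
  by move=> revM; rewrite Dalpha_pi_dual.
have biss M : reversible_generator pi M ->
    Dalpha alpha pi M L = Dalpha alpha pi M Lpi.
  by move=> revM; rewrite -!swapl ?Dalpha_pi_dual //; exact: rev_ge0.
have revMfs : reversible_generator pi Mfs by exact: reversible_power_mean_rev.
split; [|split; [|split; [|split]]].
- split; last by split => //; exact: revE.
  by apply: eq_unique_minimizer mins => M /rev_ge0 M0; rewrite swapl.
- split; first exact: min.
  split; last exact: revE.
  by apply: eq_unique_minimizer min => M /rev_ge0 M0; rewrite swapl.
- move=> Mb revMb; have Mb0 := rev_ge0 _ revMb.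
  split; first exact: Dalpha_pythagoras.
  rewrite -swapl // (Dalpha_pythagoras _ pi_gt0 _ als0 als1 _ L_ge0) //.
  by rewrite addeC !swapl.
- split; first exact: bis.
  split; first exact: biss.
  move=> _ Ls /adjE E; rewrite bis // biss //.
  by split; apply: eq_Dalpha => // x y xy; rewrite E.
- move=> Mb revMb; have Mb0 := rev_ge0 _ revMb.
  split; first exact: Dalpha_parallelogram.
  have := Dalpha_parallelogram _ pi_gt0 _ als0 als1 _ L_ge0 _ revMb.
  by rewrite !swapl // addeC => ->; rewrite addeC.
Qed.
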